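(* Let $V\colon\mathbb{R}^2\to\mathbb{R}$ be continuous with $\inf_{\mathbb{R}^2}V>0$, and suppose that $H^1_V(\mathbb{R}^2)$ is continuously embedded in $L^\tau_V(\mathbb{R}^2)$ for some $\tau>2$. Assume moreover that one of the following holds: (1) $V$ is uniformly continuous on $\mathbb{R}^2$; (2) there exists $m>0$ such that \[ \sup_{\substack{x\neq y\\ |y-x|\le m/\sqrt{V(y)}}}\frac{|V(y)-V(x)|}{|y-x|}=o\big(V^{3/2}(y)\big)\quad\text{as }|y|\to+\infty . \] Then the embedding of $H^1_V(\mathbb{R}^2)$ in $L^\tau_V(\mathbb{R}^2)$ is not compact.
   Context: $H^1_V(\mathbb{R}^2)$ is the completion of $C_0^\infty(\mathbb{R}^2)$ with respect to the norm $\|u\|_V=\left(\int_{\mathbb{R}^2}(|\nabla u|^2+V(x)|u|^2)\,dx\right)^{1/2}$. $L^\tau_V(\mathbb{R}^2)$ is the space of measurable $u$ with $\int_{\mathbb{R}^2}V(x)|u|^\tau dx<+\infty$, normed by $\left(\int V|u|^\tau\right)^{1/\tau}$. *)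

(* Defs.v *)
From HB Require Import structures.
From mathcomp Require Import all_boot all_order all_algebra.
From mathcomp Require Import all_classical all_reals all_analysis.
Set Implicit Arguments. Unset Strict Implicit. Unset Printing Implicit Defensive.
Import Order.TTheory GRing.Theory Num.Theory.
Import numFieldNormedType.Exports.
Local Open Scope classical_set_scope.
Local Open Scope ring_scope.

Definition enorm (R : realType) (p : R * R) : R := Num.sqrt (p.1 ^+ 2 + p.2 ^+ 2).

Definition leb2 (R : realType) := ((@lebesgue_measure R) \x (@lebesgue_measure R))%E.

Fixpoint diffk (R : realType) (k : nat) (f : R * R -> R) : Prop :=
  match k with
  | 0%N => True
  | k.+1 => (forall x, differentiable f x) /\ (forall v : R * R, diffk k ('D_v f))
  end.

Definition test_fun (R : realType) (f : R * R -> R) : Prop :=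
  (forall k, diffk k f) /\ exists r : R, forall x, r < enorm x -> f x = 0.

Definition grad2 (R : realType) (u : R * R -> R) (x : R * R) : R :=
  ('D_(1, 0) u x) ^+ 2 + ('D_(0, 1) u x) ^+ 2.

Definition normV (R : realType) (V : R * R -> R) (u : R * R -> R) : R :=
  Num.sqrt (\int[@leb2 R]_(x in [set: R * R]) (grad2 u x + V x * u x ^+ 2)).

Definition LnormV (R : realType) (V : R * R -> R) (tau : R) (u : R * R -> R) : R :=
  (\int[@leb2 R]_(x in [set: R * R]) (V x * (`|u x| `^ tau))) `^ (tau^-1).

(* Continuous embedding H^1_V -> L^tau_V (bound on the dense subspace C_0^infty,
   which determines the embedding by continuous extension). *)
Definition cont_embedding (R : realType) (V : R * R -> R) (tau : R) : Prop :=
  exists C : R, forall u, test_fun u -> LnormV V tau u <= C * normV V u.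

(* Compactness of the embedding: every ||.||_V-bounded sequence of test functions
   (dense in H^1_V) has a subsequence which is Cauchy (hence convergent, L^tau_V
   being complete) in L^tau_V. *)
Definition compact_embedding (R : realType) (V : R * R -> R) (tau : R) : Prop :=
  forall u : nat -> (R * R -> R),
    (forall n, test_fun (u n)) ->
    (exists M : R, forall n, normV V (u n) <= M) ->
    exists phi : nat -> nat, (forall n, (phi n < phi n.+1)%N) /\
      forall eps : R, 0 < eps -> exists N : nat, forall n m, (N <= n)%N -> (N <= m)%N ->
        LnormV V tau (fun x => u (phi n) x - u (phi m) x) < eps.

Definition unif_cont (R : realType) (V : R * R -> R) : Prop :=
  forall eps : R, 0 < eps -> exists delta : R, 0 < delta /\
    forall x y : R * R, enorm (x - y) < delta -> `|V x - V y| < eps.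

Definition cond2 (R : realType) (V : R * R -> R) (m : R) : Prop :=
  forall eps : R, 0 < eps -> exists Rad : R, forall y : R * R, Rad < enorm y ->
    forall x : R * R, x != y -> enorm (y - x) <= m / Num.sqrt (V y) ->
      `|V y - V x| / enorm (y - x) <= eps * (V y `^ (3 / 2)).

(* Main.v *)
Require Import Defs.
From HB Require Import structures.
From mathcomp Require Import all_boot all_order all_algebra.
From mathcomp Require Import all_classical all_reals all_analysis.
From mathcomp Require Import measurable_realfun ring lra.
Import Order.TTheory GRing.Theory Num.Theory.
Import numFieldNormedType.Exports.
Local Open Scope classical_set_scope.
Local Open Scope ring_scope.

(** Either hypothesis on [V] makes [V] comparable to the constant [V y] on the
    ball of radius [m / sqrt (V y)] around any [y] far from the origin.  In
    dimension two, a fixed bump rescaled to this ball has Dirichlet energy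
    independent of the scale, and the weight [V] of the ball is of order one, so
    its norms in [H^1_V] and [L^tau_V] are bounded above and below independently
    of [y].  Bumps with disjoint supports drifting to infinity then form a
    bounded sequence in [H^1_V] without an [L^tau_V]-Cauchy subsequence.

    The bumps are products of the functions [exp (-1/t)] of four affine forms,
    so they are supported in squares, and every integral needed is bounded by
    that of a multiple of the indicator of a square. *)

(** * The functions t^(-k) exp(-1/t), flat at the origin *)

Section flat_exp.
Context {R : realType}.
Implicit Types (k : nat) (t x : R).

(** Differentiating exp(-1/t) produces powers of 1/t; carrying the exponent [k] keeps all
    derivatives in the span of one family. *)
Definition flat_exp k t : R :=
  if 0 < t then t^-1 ^+ k * expR (- t^-1) else 0.

Lemma flat_exp_le0 k t : t <= 0 -> flat_exp k t = 0.
Proof. by rewrite /flat_exp leNgt => /negbTE ->. Qed.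

Lemma flat_exp_ge0 k t : 0 <= flat_exp k t.
Proof.
rewrite /flat_exp; case: ifPn => // t0.
by rewrite mulr_ge0 ?expR_ge0// exprn_ge0// invr_ge0 ltW.
Qed.

(** For positive [k], raise x/k <= exp(x/k) to the power [k]. *)
Lemma expR_ge_pow k x : 0 <= x -> x ^+ k <= k%:R ^+ k * expR x.
Proof.
case: k => [|k] x0; first by rewrite !expr0 mul1r -[1]expR0 ler_expR.
have -> : expR x = expR (x / k.+1%:R) ^+ k.+1.
  by rewrite -expRM_natl mulrC divfK.
rewrite -exprMn lerXn2r// ?nnegrE ?mulr_ge0 ?expR_ge0//.
rewrite -ler_pdivrMl ?ltr0n// mulrC.
by apply: le_trans (expR_ge1Dx _); rewrite lerDr.
Qed.

Lemma flat_exp_bound k t : flat_exp k t <= k%:R ^+ k.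
Proof.
rewrite /flat_exp; case: ifPn => t0; last by rewrite exprn_ge0.
by rewrite expRN ler_pdivrMr ?expR_gt0// expR_ge_pow// invr_ge0 ltW.
Qed.

(** Splitting off a factor [t] turns boundedness of the next function into decay at 0, and also
    computes the difference quotient there. *)
Lemma flat_expS k t : flat_exp k t = t * flat_exp k.+1 t.
Proof.
rewrite /flat_exp; case: ifPn => t0; last by rewrite mulr0.
by rewrite exprS !mulrA mulfV ?mul1r// gt_eqF.
Qed.

Lemma flat_exp_cvg0 k : flat_exp k x @[x --> 0] --> (0 : R).
Proof.
apply/cvgr0Pnorm_le => e e0.
have K0 : 0 < k.+1%:R ^+ k.+1 :> R by rewrite exprn_gt0.
near=> x.
rewrite flat_expS normrM (ger0_norm (flat_exp_ge0 _ _)).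
apply: (@le_trans _ _ (`|x| * k.+1%:R ^+ k.+1)).
  by rewrite ler_wpM2l// flat_exp_bound.
rewrite -ler_pdivlMr//.
near: x; apply: cvgr0_norm_le; first exact: cvg_id.
by rewrite divr_gt0.
Unshelve. all: by end_near. Qed.

Lemma is_derive_flat_exp k t : is_derive t 1 (flat_exp k)
  (flat_exp k.+2 t - k%:R * flat_exp k.+1 t).
Proof.
have [t0|t0|<-] := ltgtP 0 t.
- have tn0 : t != 0 by rewrite gt_eqF.
  have dV : is_derive t 1 (fun y : R => y^-1) (- t ^- 2).
    apply: is_derive_eq; first exact: is_deriveV.
    by rewrite /= /GRing.scale /= mulr1.
  have dE : is_derive t 1 (fun y : R => expR (- y^-1)) (expR (- t^-1) * t ^- 2).
    apply: (@is_derive1_comp _ expR (fun y : R => - y^-1)).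
    by apply: is_derive_eq; rewrite opprK.
  have := is_deriveM (is_deriveX k dV) dE.
  set d := (X in is_derive _ _ _ X).
  have -> : d = flat_exp k.+2 t - k%:R * flat_exp k.+1 t.
    (* Here [y] stands for 1/t and [E] for exp(-1/t). The case n = 0 is separate because of [n.-1];
       its coefficient vanishes. *)
    have ringE (n : nat) (y E : R) :
        y ^+ n * (E * y ^+ 2) + E * (n%:R * y ^+ n.-1 * - y ^+ 2) =
        y ^+ n.+2 * E - n%:R * (y ^+ n.+1 * E).
      by case: n => [|n]; rewrite -?pred_Sn ?mulr0n ?exprS; ring.
    by rewrite /d /flat_exp t0 exprfctE -exprVn; exact: ringE.
  apply: near_eq_is_derive; near=> y.
  rewrite /flat_exp ifT ?exprfctE//; near: y; exact: lt_nbhsr.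
- have : is_derive t 1 (cst (0 : R) : R -> R) 0 by exact: is_derive_cst.
  rewrite !flat_exp_le0 1?ltW// mulr0 subr0.
  apply: near_eq_is_derive; near=> y.
  rewrite flat_exp_le0//; apply: ltW; near: y; exact: lt_nbhsl.
- rewrite !flat_exp_le0// mulr0 subr0.
  (* At 0 the difference quotient is exactly [flat_exp k.+1 h], which tends to 0. *)
  have H : h^-1 *: ((flat_exp k \o shift 0) (h *: 1) - flat_exp k 0)
      @[h --> 0^'] --> (0 : R).
    apply: cvg_trans (@cvg_within_filter _ _ _ _ _ _ _ (@flat_exp_cvg0 k.+1)).
    apply: near_eq_cvg; near=> h.
    have h0 : h != 0 by near: h; exact: nbhs_dnbhs_neq.
    rewrite /= addr0 (flat_exp_le0 k 0)// subr0 /GRing.scale /= mulr1.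
    by rewrite [in RHS]flat_expS mulKf.
  split; [apply/cvg_ex; by exists 0 | exact: cvg_lim H].
Unshelve. all: by end_near. Qed.
End flat_exp.

(** * An algebra of smooth functions closed under differentiation *)

Section flat_algebra.
Context {R : realType}.
Implicit Types (f g : R * R -> R) (x v : R * R) (a b c s : R).

Definition aff a b c x : R := a * x.1 + b * x.2 + c.

Lemma is_diff_aff a b c x :
  is_diff x (aff a b c) (fun v => a * v.1 + b * v.2).
Proof.
have d1 : is_diff x (fst : R * R -> R) fst.
  apply: DiffDef.
    by apply: linear_differentiable; move=> ?; exact: cvg_fst.
  by apply: diff_lin; move=> ?; exact: cvg_fst.
have d2 : is_diff x (snd : R * R -> R) snd.
  apply: DiffDef.
    by apply: linear_differentiable; move=> ?; exact: cvg_snd.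
  by apply: diff_lin; move=> ?; exact: cvg_snd.
have -> : aff a b c = a *: (fst : R * R -> R) + b *: (snd : R * R -> R) + cst c.
  by apply/funext.
have := is_diffD (is_diffD (is_diffZ a d1) (is_diffZ b d2)) (is_diff_cst c x).
by rewrite addr0.
Qed.

Lemma differentiable_flat_aff k a b c x :
  differentiable (flat_exp k \o aff a b c) x.
Proof.
apply: differentiable_comp; first by have [] := is_diff_aff a b c x.
by apply/derivable1_diffP; have [] := is_derive_flat_exp k (aff a b c x).
Qed.

Lemma derive_flat_aff k a b c v x : 'D_v (flat_exp k \o aff a b c) x =
  (a * v.1 + b * v.2) *
  (flat_exp k.+2 (aff a b c x) - k%:R * flat_exp k.+1 (aff a b c x)).
Proof.
have [da dE] := is_diff_aff a b c x.
have [df fE] := is_derive_flat_exp k (aff a b c x).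
rewrite deriveE; last exact: differentiable_flat_aff.
rewrite diff_comp//; last exact/derivable1_diffP.
by rewrite /= dE diff1E; [rewrite derive1E fE|exact/derivable1_diffP].
Qed.

(* Stable under directional derivatives because
   [flat_exp k]' = [flat_exp k.+2] - k [flat_exp k.+1]. *)
Inductive flat_alg : (R * R -> R) -> Prop :=
| flat_alg_cst c : flat_alg (cst c)
| flat_alg_aff k a b c : flat_alg (flat_exp k \o aff a b c)
| flat_algD f g : flat_alg f -> flat_alg g -> flat_alg (f + g)
| flat_algM f g : flat_alg f -> flat_alg g -> flat_alg (f * g).

Lemma differentiable_flat_alg f x : flat_alg f -> differentiable f x.
Proof.
elim=> [c|k a b c|{}f g _ ? _ ?|{}f g _ ? _ ?].
- exact: differentiable_cst.
- exact: differentiable_flat_aff.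
- exact: differentiableD.
- exact: differentiableM.
Qed.

Lemma derivable_flat_alg f x v : flat_alg f -> derivable f x v.
Proof. by move=> ff; exact/diff_derivable/differentiable_flat_alg. Qed.

Lemma derive_flat_alg f v : flat_alg f -> flat_alg ('D_v f).
Proof.
elim=> [c|k a b c|{}f g ff Df gf Dg|{}f g ff Df gf Dg].
- rewrite (_ : 'D_v _ = cst 0); first exact: flat_alg_cst.
  by apply/funext => x; rewrite derive_cst.
- rewrite (_ : 'D_v _ = cst (a * v.1 + b * v.2) *
      ((flat_exp k.+2 \o aff a b c) +
       cst (- k%:R) * (flat_exp k.+1 \o aff a b c))).
    by apply: flat_algM; [|apply: flat_algD; [|apply: flat_algM]]; constructor.
  by apply/funext => x; rewrite derive_flat_aff !fctE/= mulNr.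
- rewrite (_ : 'D_v _ = 'D_v f + 'D_v g); first exact: flat_algD.
  by apply/funext => x; rewrite deriveD//; exact: derivable_flat_alg.
- rewrite (_ : 'D_v _ = f * 'D_v g + g * 'D_v f).
    by apply: flat_algD; exact: flat_algM.
  by apply/funext => x; rewrite deriveM//; exact: derivable_flat_alg.
Qed.

Lemma diffk_flat_alg k f : flat_alg f -> diffk k f.
Proof.
elim: k f => //= k IHk f ff; split=> [x|v].
  exact: differentiable_flat_alg.
exact/IHk/derive_flat_alg.
Qed.

End flat_algebra.

(** * Rescaled bumps on squares and their gradients *)

Section bump.
Context {R : realType}.
Implicit Types (p x v : R * R) (s r : R).

Definition box p r : set (R * R) :=
  `[p.1 - r, p.1 + r] `*` `[p.2 - r, p.2 + r].

Lemma boxP p r x : box p r x <-> `|x.1 - p.1| <= r /\ `|x.2 - p.2| <= r.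
Proof. by rewrite /box /= !in_itv /= -!ler_distl. Qed.

(** The four affine forms are positive together exactly in the open square of half-side 1/s about
    [p]. The form as a product of compositions makes membership in [flat_alg] immediate. *)
Definition bump s p : R * R -> R :=
  (flat_exp 0 \o aff s 0 (1 - s * p.1)) *
  (flat_exp 0 \o aff (- s) 0 (1 + s * p.1)) *
  (flat_exp 0 \o aff 0 s (1 - s * p.2)) *
  (flat_exp 0 \o aff 0 (- s) (1 + s * p.2)).

Lemma bumpE s p x : bump s p x =
  flat_exp 0 (1 + s * (x.1 - p.1)) * flat_exp 0 (1 - s * (x.1 - p.1)) *
  flat_exp 0 (1 + s * (x.2 - p.2)) * flat_exp 0 (1 - s * (x.2 - p.2)).
Proof.
rewrite /bump !fctE /= /aff.
by congr (_ * _ * _ * _); congr (flat_exp _ _); ring.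
Qed.

Lemma flat_exp0_le1 (t : R) : flat_exp 0 t <= 1.
Proof. by have := flat_exp_bound 0 t; rewrite expr0. Qed.

Lemma bump_ge0 s p x : 0 <= bump s p x.
Proof. by rewrite bumpE !mulr_ge0 ?flat_exp_ge0. Qed.

Lemma bump_le1 s p x : bump s p x <= 1.
Proof. by rewrite bumpE !mulr_ile1 ?mulr_ge0 ?flat_exp_ge0 ?flat_exp0_le1. Qed.

(** A nonpositive argument annihilates [flat_exp] of every order, hence the bump and its derivatives
    alike. *)
Lemma not_box_cases s p x : 0 < s -> ~ box p s^-1 x ->
  [\/ 1 + s * (x.1 - p.1) <= 0, 1 - s * (x.1 - p.1) <= 0,
      1 + s * (x.2 - p.2) <= 0 | 1 - s * (x.2 - p.2) <= 0].
Proof.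
move=> s0; rewrite boxP => /not_andP[] /negP; rewrite -ltNge -(ltr_pM2l s0);
  rewrite mulfV ?gt_eqF// -[X in X * `|_|](gtr0_norm s0) -normrM;
  rewrite ltr_normr => /orP[] h.
- by apply: Or42; lra.
- by apply: Or41; lra.
- by apply: Or44; lra.
- by apply: Or43; lra.
Qed.

Lemma bump_out s p x : 0 < s -> ~ box p s^-1 x -> bump s p x = 0.
Proof.
move=> s0 /(not_box_cases _ _ _ s0) h; rewrite bumpE.
by case: h => h; rewrite (flat_exp_le0 _ _ h) ?mulr0 ?mul0r.
Qed.

Lemma flat_exp0_half (t : R) : 1 / 2 <= t -> expR (- 2) <= flat_exp 0 t.
Proof.
move=> t2; have t0 : 0 < t by lra.
rewrite /flat_exp t0 expr0 mul1r ler_expR lerN2 -[leRHS]invrK lef_pV2 ?posrE//.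
by rewrite -div1r.
Qed.

(** On the square of half the size all four arguments are at least 1/2, so each factor is at least
    exp(-2). *)
Lemma bump_in s p x : 0 < s -> box p (2 * s)^-1 x ->
  expR (- 2) ^+ 4 <= bump s p x.
Proof.
move=> s0 /boxP[h1 h2].
have hf (d : R) : `|d| <= (2 * s)^-1 ->
    1 / 2 <= 1 + s * d /\ 1 / 2 <= 1 - s * d.
  move=> hd; have : `|s * d| <= 2^-1.
    rewrite normrM gtr0_norm// -ler_pdivlMl// mulrC -invfM; exact: hd.
  by rewrite ler_norml => /andP[? ?]; split; lra.
have [a1 a2] := hf _ h1; have [a3 a4] := hf _ h2.
rewrite bumpE (_ : expR (- 2) ^+ 4 =
  expR (- 2) * expR (- 2) * expR (- 2) * expR (- 2));
  last by rewrite !exprS; ring.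
by rewrite !ler_pM ?mulr_ge0 ?expR_ge0// flat_exp0_half.
Qed.

Lemma flat_alg_bump s p : flat_alg (bump s p).
Proof. by do !apply: flat_algM; exact: flat_alg_aff. Qed.

Lemma test_fun_bump s p : 0 < s -> test_fun (bump s p).
Proof.
move=> s0; split=> [k|]; first exact/diffk_flat_alg/flat_alg_bump.
(* Each coordinate of this point dominates, in absolute value, that of any point of the square. *)
exists (enorm (`|p.1| + s^-1, `|p.2| + s^-1)) => x; apply: contraPP => xp.
have /boxP[h1 h2] : box p s^-1 x by apply: contrapT => /(bump_out _ _ _ s0).
apply/negP; rewrite -leNgt /enorm /= ler_wsqrtr// lerD//.
  rewrite -real_normK ?num_real// lerXn2r// ?nnegrE//.
    by rewrite addr_ge0// invr_ge0 ltW.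
  by rewrite -lerBlDl; apply: le_trans h1; exact: lerB_dist.
rewrite -real_normK ?num_real// lerXn2r// ?nnegrE//.
  by rewrite addr_ge0// invr_ge0 ltW.
by rewrite -lerBlDl; apply: le_trans h2; exact: lerB_dist.
Qed.

Lemma derive_bump v s p x : 'D_v (bump s p) x =
  s * v.1 *
    (flat_exp 2 (1 + s * (x.1 - p.1)) * flat_exp 0 (1 - s * (x.1 - p.1)) -
     flat_exp 0 (1 + s * (x.1 - p.1)) * flat_exp 2 (1 - s * (x.1 - p.1))) *
    (flat_exp 0 (1 + s * (x.2 - p.2)) * flat_exp 0 (1 - s * (x.2 - p.2))) +
  s * v.2 *
    (flat_exp 2 (1 + s * (x.2 - p.2)) * flat_exp 0 (1 - s * (x.2 - p.2)) -
     flat_exp 0 (1 + s * (x.2 - p.2)) * flat_exp 2 (1 - s * (x.2 - p.2))) *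
    (flat_exp 0 (1 + s * (x.1 - p.1)) * flat_exp 0 (1 - s * (x.1 - p.1))).
Proof.
have fa a b c : flat_alg (flat_exp 0 \o aff a b c : R * R -> R).
  exact: flat_alg_aff.
have dM (f g : R * R -> R) : flat_alg f -> flat_alg g ->
    'D_v (f * g) x = f x * 'D_v g x + g x * 'D_v f x.
  by move=> ff fg; rewrite deriveM//; exact: derivable_flat_alg.
rewrite /bump dM//; last by do !apply: flat_algM.
rewrite dM//; last by apply: flat_algM.
rewrite dM// !derive_flat_aff !fctE /=.
rewrite (_ : aff s 0 _ x = 1 + s * (x.1 - p.1)); last by rewrite /aff; ring.
rewrite (_ : aff (- s) 0 _ x = 1 - s * (x.1 - p.1)); last by rewrite /aff; ring.
rewrite (_ : aff 0 s _ x = 1 + s * (x.2 - p.2)); last by rewrite /aff; ring.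
rewrite (_ : aff 0 (- s) _ x = 1 - s * (x.2 - p.2)); last by rewrite /aff; ring.
ring.
Qed.

Lemma derive_bump_out v s p x : 0 < s -> ~ box p s^-1 x ->
  'D_v (bump s p) x = 0.
Proof.
move=> s0 /(not_box_cases _ _ _ s0) h; rewrite derive_bump.
by case: h => h; rewrite !(flat_exp_le0 _ _ h); ring.
Qed.

(** [flat_exp 2] is at most 2^2 = 4, and a difference of two numbers in [0, 4] has modulus at most
    4. Each partial derivative is thus at most 4s in modulus, and two squares add up to 32 s^2. *)
Lemma grad2_bump_le s p x : 0 < s -> grad2 (bump s p) x <= 32 * s ^+ 2.
Proof.
move=> s0.
have hb (a b c d : R) :
    `|(flat_exp 2 a * flat_exp 0 b - flat_exp 0 a * flat_exp 2 b) *
      (flat_exp 0 c * flat_exp 0 d)| <= 4.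
  have := flat_exp0_le1 a; have := flat_exp_ge0 0 a.
  have := flat_exp0_le1 b; have := flat_exp_ge0 0 b.
  have := flat_exp_bound 2 a; have := flat_exp_ge0 2 a.
  have := flat_exp_bound 2 b; have := flat_exp_ge0 2 b.
  have cd1 : flat_exp 0 c * flat_exp 0 d <= 1.
    by rewrite mulr_ile1 ?flat_exp_ge0 ?flat_exp0_le1.
  have cd0 : 0 <= flat_exp 0 c * flat_exp 0 d by rewrite mulr_ge0 ?flat_exp_ge0.
  move=> b20 b24 a20 a24 b0 b1 a0 a1.
  rewrite normrM (ger0_norm cd0) -[4]mulr1 ler_pM//.
  rewrite ler_norml; apply/andP; split; nra.
have sq (e : R) : `|e| <= 4 -> (s * e) ^+ 2 <= 16 * s ^+ 2.
  rewrite ler_norml => /andP[e1 e2].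
  by rewrite exprMn mulrC ler_wpM2r ?sqr_ge0//; nra.
rewrite /grad2 (_ : 32 * s ^+ 2 = 16 * s ^+ 2 + 16 * s ^+ 2); last by ring.
rewrite !derive_bump /= !mulr1 !mulr0 !mul0r addr0 add0r -!mulrA.
by apply: lerD; apply: sq; rewrite hb.
Qed.

End bump.

(** * Integrals compared with indicators of squares *)

Section integral_bounds.
Context {R : realType}.
Implicit Types (p : R * R) (r c : R).

(* [ge0_le_integral] asks for measurability; comparing suprema over simple
   functions does not, so the Borel structure of the plane is never needed. *)
Lemma ge0_le_integral_nonmeas (d : measure_display) (T : measurableType d)
    (mu : {measure set T -> \bar R}) (f g : T -> \bar R) :
  (forall x, 0 <= f x)%E -> (forall x, f x <= g x)%E ->
  (\int[mu]_x f x <= \int[mu]_x g x)%E.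
Proof.
move=> f0 fg; have g0 x : (0 <= g x)%E by exact: le_trans (f0 x) (fg x).
rewrite !ge0_integralTE//; apply: ereal_sup_le => _ [h /= hf <-].
by exists h => // x; exact: le_trans (hf x) (fg x).
Qed.

Let plane := (measurableTypeR R * measurableTypeR R)%type.
Let mu : {measure set plane -> \bar R} :=
  (@lebesgue_measure R \x @lebesgue_measure R)%E.

Lemma measurable_box p r : measurable (box p r : set plane).
Proof. by apply: measurableX; exact: measurable_itv. Qed.

Lemma leb2_box p r : 0 <= r -> @leb2 R (box p r) = ((2 * r) ^+ 2)%:E.
Proof.
move=> r0; rewrite /leb2 /box.
rewrite (product_measure1E lebesgue_measure lebesgue_measure);
  [|exact: measurable_itv..].
have itvE (a : R) : lebesgue_measure (`[a - r, a + r] : set R) = (2 * r)%:E.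
  rewrite lebesgue_measure_itv /= lte_fin; case: ltP => h.
    by rewrite -EFinB; congr EFin; ring.
  by congr EFin; lra.
by rewrite expr2 EFinM; congr (_ * _)%E; exact: itvE.
Qed.

Lemma integral_indic_box c p r : 0 <= c -> 0 <= r ->
  (\int[@leb2 R]_x (c * \1_(box p r) x)%:E = (c * (2 * r) ^+ 2)%:E)%E.
Proof.
move=> c0 r0; have mB := measurable_box p r.
rewrite (@integralZl_indic _ _ _ mu _ measurableT (fun=> box p r))//.
  by rewrite (integral_indic mu measurableT mB) setIT EFinM -(leb2_box p r).
by rewrite ltNge c0.
Qed.

Lemma Rintegral_le_box (f : R * R -> R) c p r : 0 <= c -> 0 <= r ->
  (forall x, 0 <= f x) -> (forall x, f x <= c * \1_(box p r) x) ->
  \int[@leb2 R]_x f x <= c * (2 * r) ^+ 2.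
Proof.
move=> c0 r0 f0 fc; rewrite /Rintegral.
have h : (\int[@leb2 R]_x (f x)%:E <= (c * (2 * r) ^+ 2)%:E)%E.
  rewrite -(integral_indic_box c p r)//.
  by apply: (@ge0_le_integral_nonmeas _ _ mu) => x; rewrite lee_fin.
rewrite -lee_fin fineK// ge0_fin_numE; first exact: le_lt_trans h (ltry _).
by apply: (@integral_ge0 _ _ _ mu) => x _; rewrite lee_fin.
Qed.

(* The upper bound on [f] only serves finiteness: [\int] is [0] when the
   integral is infinite. *)
Lemma Rintegral_ge_box (f : R * R -> R) c p r c' p1 p2 r1 r2 :
  0 <= c -> 0 <= r -> 0 <= c' -> 0 <= r1 -> 0 <= r2 ->
  (forall x, f x <= c' * \1_(box p1 r1) x + c' * \1_(box p2 r2) x) ->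
  (forall x, c * \1_(box p r) x <= f x) ->
  c * (2 * r) ^+ 2 <= \int[@leb2 R]_x f x.
Proof.
move=> c0 r0 c'0 r10 r20 fc' fc; rewrite /Rintegral.
have i0 (b : R) (q : R * R) s x : 0 <= b -> 0 <= b * \1_(box q s) x.
  by move=> b0; rewrite mulr_ge0.
have f0 x : (0 <= (f x)%:E)%E.
  by rewrite lee_fin; exact: le_trans (i0 _ _ _ _ c0) (fc x).
have hl : ((c * (2 * r) ^+ 2)%:E <= \int[@leb2 R]_x (f x)%:E)%E.
  rewrite -(integral_indic_box c p r)//.
  by apply: (@ge0_le_integral_nonmeas _ _ mu) => x; rewrite lee_fin// i0.
have hu : (\int[@leb2 R]_x (f x)%:E < +oo)%E.
  pose g (q : R * R) s x : \bar R := (c' * \1_(box q s) x)%:E.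
  apply: (@le_lt_trans _ _ (\int[@leb2 R]_x (g p1 r1 x + g p2 r2 x))%E).
    by apply: (@ge0_le_integral_nonmeas _ _ mu) => // x; rewrite -EFinD lee_fin.
  have mg q s : measurable_fun [set: plane] (g q s).
    apply/measurable_EFinP; apply: measurable_funM => //.
    by apply: measurable_indic; exact: measurable_box.
  have g0 q s (x : plane) : setT x -> (0 <= g q s x)%E.
    by move=> _; rewrite lee_fin i0.
  rewrite (ge0_integralD mu measurableT (g0 _ _) (mg _ _) (g0 _ _) (mg _ _)).
  by rewrite !integral_indic_box// -EFinD ltry.
by rewrite -lee_fin fineK// ge0_fin_numE//; apply: (@integral_ge0 _ _ _ mu).
Qed.

End integral_bounds.

(** * Comparability of the potential and norm estimates for bumps *)

Section concentration.
Context {R : realType}.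
Implicit Types (V : R * R -> R) (p x y : R * R) (m c s : R).

(** The factor 2 is a crude substitute for sqrt 2. *)
Lemma enorm_box p r x : box p r x -> enorm (p - x) <= 2 * r.
Proof.
move=> /boxP[]; rewrite distrC => h1; rewrite distrC => h2.
have r0 : 0 <= r by exact: le_trans h1.
rewrite /enorm /= -[leRHS]ger0_norm ?mulr_ge0// -sqrtr_sqr ler_wsqrtr//.
by move: h1 h2; rewrite !ler_norml => /andP[? ?] /andP[? ?]; nra.
Qed.

Lemma sqrt_gt0_of_ge c (z : R) : 0 < c -> c <= z -> 0 < Num.sqrt z.
Proof. by move=> c0 cz; rewrite sqrtr_gt0; exact: lt_le_trans cz. Qed.

Lemma comparable_on_balls V c : 0 < c -> (forall x, c <= V x) ->
  (unif_cont V \/ exists m : R, 0 < m /\ cond2 V m) ->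
  exists m Rad : R, 0 < m /\ forall y x, Rad < enorm y ->
    enorm (y - x) <= m / Num.sqrt (V y) -> V y / 2 <= V x <= 3 / 2 * V y.
Proof.
move=> c0 cV; have sV y := sqrt_gt0_of_ge _ _ c0 (cV y).
have sc : 0 < Num.sqrt c by rewrite sqrtr_gt0.
case=> [uV|[m [m0 Vm]]].
- have [|d [d0 dV]] := uV (c / 2); first by rewrite divr_gt0.
  (* Since V y >= c, the radius m / sqrt (V y) is at most d/2 < d, so [V] varies by less than c/2 <=
     V y / 2. This holds for every [y], whence the threshold 0. *)
  exists (Num.sqrt c * (d / 2)), 0; split=> [|y x _ yx].
    by rewrite !mulr_gt0// invr_gt0.
  have : `|V y - V x| < c / 2.
    apply: dV; apply: le_lt_trans yx _.
    rewrite ltr_pdivrMr//; apply: (@le_lt_trans _ _ (d / 2 * Num.sqrt (V y))).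
      by rewrite mulrC ler_pM2l ?divr_gt0// ler_wsqrtr.
    by rewrite ltr_pM2r//; lra.
  by have := cV y; rewrite ltr_norml => ? /andP[? ?]; apply/andP; split; lra.
(* With eps = 1/(2m), the variation is at most eps * V^(3/2) times the radius m / sqrt V, which is
   V/2. *)
- have [|Rad hR] := Vm (2 * m)^-1; first by rewrite invr_gt0 mulr_gt0.
  exists m, Rad; split=> // y x Ry yx.
  have Vy0 : 0 < V y by exact: lt_le_trans (cV y).
  have [<-|xy] := eqVneq x y.
    by have := cV x; move=> ?; apply/andP; split; lra.
  have := hR y Ry x xy yx.
  have e0 : 0 < enorm (y - x).
    rewrite sqrtr_gt0 lt0r addr_ge0 ?sqr_ge0// andbT paddr_eq0 ?sqr_ge0//.
    rewrite !sqrf_eq0 !subr_eq0; apply: contraNN xy => /andP[/eqP e1 /eqP e2].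
    by rewrite [x]surjective_pairing [y]surjective_pairing e1 e2.
  rewrite ler_pdivrMr// => h.
  have {}h : `|V y - V x| <= V y / 2.
    apply: le_trans h _.
    have -> : V y `^ (3 / 2) = V y * Num.sqrt (V y).
      rewrite (_ : 3 / 2 = 1 + 2^-1); last by lra.
      by rewrite powRD ?powRr1 ?powR12_sqrt ?ltW// gt_eqF ?implybT.
    move: yx; rewrite ler_pdivlMr// => yx.
    rewrite (_ : V y / 2 = (2 * m)^-1 * V y * m); last by field; rewrite gt_eqF.
    rewrite !mulrA -!mulrA !ler_wpM2l//;
      rewrite ?invr_ge0 ?mulr_ge0 ?(ltW m0) ?(ltW Vy0)//.
    by rewrite mulrC.
  by move: h; rewrite ler_norml => /andP[? ?]; apply/andP; split; lra.
Qed.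

(** The integrand is at most 32 s^2 + K on a square of area (2/s)^2 and vanishes outside it. The
    gradient part of the product does not depend on [s]. *)
Lemma normV_bump_le V s p (K : R) : 0 < s -> (forall x, 0 <= V x) ->
  (forall x, box p s^-1 x -> V x <= K) ->
  normV V (bump s p) <= Num.sqrt ((32 * s ^+ 2 + K) * (2 * s^-1) ^+ 2).
Proof.
move=> s0 V0 VK; rewrite /normV ler_wsqrtr//.
have s10 : 0 <= s^-1 by rewrite invr_ge0 ltW.
have pp : box p s^-1 p by apply/boxP; rewrite !subrr normr0.
have K0 : 0 <= K := le_trans (V0 p) (VK p pp).
apply: (Rintegral_le_box _ _ p) => // [|x|x].
- by rewrite addr_ge0// mulr_ge0// sqr_ge0.
- apply: addr_ge0; first exact: addr_ge0 (sqr_ge0 _) (sqr_ge0 _).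
  exact: mulr_ge0 (V0 x) (sqr_ge0 _).
- rewrite indicE.
  case: (boolP (x \in box p s^-1)) => [|/negP]; rewrite inE => xp.
    rewrite mulr1 lerD ?grad2_bump_le// -[K]mulr1 ler_pM ?sqr_ge0 ?VK//.
    by rewrite expr_le1 ?bump_ge0 ?bump_le1.
  by rewrite mulr0 /grad2 !derive_bump_out// bump_out// expr0n /= mulr0 !addr0.
Qed.

(** On the half-size square about [p1], of area s1^(-2), the second bump vanishes and the first is
    at least exp(-2)^4. The bound [K] makes the integral finite. *)
Lemma LnormV_bumpB_ge V tau s1 s2 p1 p2 (L K : R) :
  0 < tau -> 0 < s1 -> 0 < s2 -> (forall x, 0 <= V x) -> 0 <= L ->
  (forall x, box p1 s1^-1 x -> ~ box p2 s2^-1 x) ->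
  (forall x, box p1 s1^-1 x -> L <= V x <= K) ->
  (forall x, box p2 s2^-1 x -> V x <= K) ->
  (L * (expR (- 2) ^+ 4) `^ tau * s1^-1 ^+ 2) `^ tau^-1 <=
    LnormV V tau (fun x => bump s1 p1 x - bump s2 p2 x).
Proof.
move=> tau0 s10 s20 V0 L0 disj VLK VK.
have is1 : 0 <= s1^-1 by rewrite invr_ge0 ltW.
have is2 : 0 <= s2^-1 by rewrite invr_ge0 ltW.
have pp : box p1 s1^-1 p1 by apply/boxP; rewrite !subrr normr0.
have K0 : 0 <= K by apply: (le_trans (V0 p1)); have /andP[] := VLK p1 pp.
have e0 : 0 <= expR (- 2) ^+ 4 :> R by rewrite exprn_ge0 ?expR_ge0.
have sub x : box p1 (2 * s1)^-1 x -> box p1 s1^-1 x.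
  have h : (2 * s1)^-1 <= s1^-1 by rewrite lef_pV2 ?posrE; lra.
  by move=> /boxP[h1 h2]; apply/boxP; split; exact: le_trans h.
rewrite /LnormV ge0_ler_powR// ?nnegrE.
- by rewrite invr_ge0 ltW.
- by rewrite !mulr_ge0 ?powR_ge0// sqr_ge0.
- by apply: Rintegral_ge0 => x _; rewrite mulr_ge0 ?powR_ge0.
(* The side of the half-size square, in the form expected by [Rintegral_ge_box]. *)
rewrite [s1^-1](_ : _ = 2 * (2 * s1)^-1); last by field; rewrite gt_eqF.
apply: (@Rintegral_ge_box _ _ _ p1 _ K p1 p2 s1^-1 s2^-1) => //.
- by rewrite mulr_ge0 ?powR_ge0.
- by rewrite invr_ge0 mulr_ge0// ltW.
- move=> x; have b1 := bump_le1 s1 p1 x; have b2 := bump_le1 s2 p2 x.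
  have a1 := bump_ge0 s1 p1 x; have a2 := bump_ge0 s2 p2 x.
  have u1 : `|bump s1 p1 x - bump s2 p2 x| `^ tau <= 1.
    rewrite [leRHS](_ : 1 = 1 `^ tau); last by rewrite powR1.
    rewrite ge0_ler_powR ?nnegrE ?(ltW tau0)//.
    by rewrite ler_norml; apply/andP; split; lra.
  rewrite !indicE.
  case: (boolP (x \in box p1 _)) => [|/negP]; rewrite inE => x1.
    have /andP[_ VxK] := VLK x x1.
    apply: (@le_trans _ _ (K * 1)); first by rewrite ler_pM ?powR_ge0.
    by rewrite lerDl mulr_ge0.
  case: (boolP (x \in box p2 _)) => [|/negP]; rewrite inE => x2.
    by rewrite mulr0 add0r ler_pM ?powR_ge0 ?VK.
  by rewrite !bump_out// subrr normr0 powR0 ?gt_eqF// !mulr0 addr0.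
- move=> x; rewrite indicE.
  case: (boolP (x \in box p1 _)) => [|_]; last first.
    by rewrite mulr0 mulr_ge0 ?powR_ge0.
  rewrite inE => x1; have /sub x1' := x1; have /andP[LV _] := VLK x x1'.
  rewrite mulr1 (bump_out s2)//; last exact: disj.
  rewrite subr0 ler_pM ?powR_ge0// ge0_ler_powR ?nnegrE ?(ltW tau0)//.
  by rewrite ger0_norm ?bump_ge0// bump_in.
Qed.

End concentration.

(** * The drifting sequence of bumps and the contradiction *)

Theorem corollary2p8 (R : realType) (V : R * R -> R) (tau : R) :
  continuous V ->
  (exists c : R, 0 < c /\ forall x, c <= V x) ->
  2 < tau ->
  cont_embedding V tau ->
  (unif_cont V \/ exists m : R, 0 < m /\ cond2 V m) ->
  ~ compact_embedding V tau.
Proof.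
move=> _ [c [c0 cV]] tau2 _ hV cpt.
have [m [Rad [m0 Vcmp]]] := comparable_on_balls V c c0 cV hV.
have V0 x : 0 < V x by exact: lt_le_trans (cV x).
have sV x : 0 < Num.sqrt (V x) by rewrite sqrtr_gt0.
have sc : 0 < Num.sqrt c by rewrite sqrtr_gt0.
(* The half-side 1/s is half of m / sqrt (V y), so by [enorm_box] the square lies in the ball where
   [V] is comparable to [V y]. *)
pose s y := 2 / m * Num.sqrt (V y).
have s0 y : 0 < s y by rewrite !mulr_gt0// invr_gt0.
have sE y : (s y)^-1 = m / Num.sqrt (V y) / 2.
  by rewrite /s; field; rewrite !gt_eqF.
have s2E y : (s y)^-1 ^+ 2 = m ^+ 2 / 4 / V y.
  by rewrite sE !exprMn !exprVn sqr_sqrtr ?ltW//; field; rewrite gt_eqF.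
(* A bound on all half-sides, from V >= c. *)
pose rho := m / Num.sqrt c / 2.
have rho0 : 0 < rho by rewrite !divr_gt0.
have s_rho y : (s y)^-1 <= rho.
  by rewrite sE ler_pM2r ?invr_gt0// ler_pM2l// lef_pV2 ?posrE// ler_wsqrtr.
(* All centres lie beyond [Rad]; their spacing exceeds 2 rho, which makes the squares pairwise
   disjoint. *)
pose y n : R * R := (`|Rad| + 1 + (2 * rho + 1) * n%:R, 0).
have y_far n : Rad < enorm (y n).
  have h : 0 <= (2 * rho + 1) * n%:R.
    by rewrite mulr_ge0// addr_ge0// mulr_ge0// ltW.
  rewrite /enorm /= expr0n addr0 sqrtr_sqr ger0_norm ?addr_ge0//.
  by have := ler_norm Rad; lra.
have Vbox n x : box (y n) (s (y n))^-1 x ->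
    V (y n) / 2 <= V x <= 3 / 2 * V (y n).
  move=> /enorm_box h; apply: Vcmp => //; apply: le_trans h _.
  by rewrite sE mulrC divfK.
have disj n k : n <> k -> forall x,
    box (y n) (s (y n))^-1 x -> ~ box (y k) (s (y k))^-1 x.
  move=> nk x /boxP[+ _] /boxP[+ _] => h1 h2.
  have {}h1 := le_trans h1 (s_rho _); have {}h2 := le_trans h2 (s_rho _).
  have : `|(y n).1 - (y k).1| <= 2 * rho.
    apply: le_trans (ler_distD x.1 _ _) _.
    by rewrite distrC [leRHS](_ : _ = rho + rho) ?lerD//; ring.
  rewrite /y /= (_ : _ - _ = (2 * rho + 1) * (n%:R - k%:R)); last by ring.
  have : 1 <= `|n%:R - k%:R : R|.
    rewrite ler_normr; apply/orP.
    have [h|h|//] := ltngtP n k; move: h; rewrite -(ler_nat R) -natr1 => h.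
      by right; lra.
    by left; lra.
  have r1 : 0 < 2 * rho + 1 by lra.
  by rewrite normrM (gtr0_norm r1); nra.
pose u n := bump (s (y n)) (y n).
have [||phi [phiS cau]] := cpt u.
- by move=> n; exact: test_fun_bump.
(* The area (2/s)^2 equals m^2 / V(y n): the gradient contributes 32 * 4 = 128, the potential (3/2)
   V(y n) times the area. *)
- exists (Num.sqrt (128 + 3 / 2 * m ^+ 2)) => n.
  have VK x : box (y n) (s (y n))^-1 x -> V x <= 3 / 2 * V (y n).
    by move=> /Vbox /andP[].
  apply: le_trans (normV_bump_le _ _ _ _ (s0 _) (fun x => ltW (V0 x)) VK) _.
  rewrite ler_wsqrtr// mulrDl [(2 / _) ^+ 2]exprMn.
  rewrite (_ : 32 * _ * _ = 128); last by field; rewrite gt_eqF.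
  rewrite s2E lerD2l.
  by rewrite le_eqVlt; apply/orP; left; apply/eqP; field; rewrite !gt_eqF.
set beta : R := (expR (- 2) ^+ 4) `^ tau.
have beta0 : 0 < beta by rewrite powR_gt0// exprn_gt0// expR_gt0.
(* The threshold is the lower bound for the distance of two distinct bumps: with L = V/2 and s^(-2)
   = m^2 / (4V), the potential cancels. Two consecutive terms already contradict the Cauchy
   property. *)
have [|N /(_ N N.+1 (leqnn _) (leqnSn _))] :=
  cau ((beta * m ^+ 2 / 8) `^ tau^-1).
  by rewrite powR_gt0// divr_gt0// mulr_gt0// exprn_gt0.
apply/negP; rewrite -leNgt.
have nk : phi N <> phi N.+1 by move=> h; have := phiS N; rewrite h ltnn.
have tau0 : 0 < tau by lra.
have V2 n : 0 <= V (y n) / 2 by rewrite divr_ge0// ltW.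
have := @LnormV_bumpB_ge _ V tau _ _ (y (phi N)) (y (phi N.+1)) _
  (Num.max (3 / 2 * V (y (phi N))) (3 / 2 * V (y (phi N.+1))))
  tau0 (s0 _) (s0 _) (fun x => ltW (V0 x)) (V2 (phi N)) (disj _ _ nk).
rewrite s2E (_ : V _ / 2 * _ * _ = beta * m ^+ 2 / 8); last first.
  by rewrite -/beta; field; rewrite gt_eqF.
apply=> x /Vbox /andP[Vl Vu]; last by rewrite le_max Vu orbT.
by rewrite Vl le_max Vu.
Qed.
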